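(* Let $E_\bullet$ be a tower over $F$ in the stable homotopy category and let $X$ be a spectrum. Suppose that level $n$ detection with respect to $X$ holds for all $n\in\mathbb{Z}$. Then for each $n\in\mathbb Z$ there is a short exact sequence, natural in $\mathrm{End}(X)$, $$0\to\mathrm{Im}(\Sigma^{-1}\theta_{n-1})\to[X,E_n]^*\to\Phi_n[X,F]^*\to0,$$ which is formed by pullback along the natural surjection $\Phi_n[X,F]^*\twoheadrightarrow\Phi_n[X,F]^*/\Phi_{n+1}[X,F]^*$ of a short exact sequence $$0\to\mathrm{Im}(\Sigma^{-1}\theta_{n-1})\to\mathrm{Ker}(\theta_n)\to\Phi_n[X,F]^*/\Phi_{n+1}[X,F]^*\to0.$$
   Context: A tower $E_\bullet$ over $F$ consists of spectra $E_n$ ($n\in\mathbb{Z}$), maps $e_n:E_n\to E_{n-1}$ and maps $f_n:E_n\to F$ with $f_n=f_{n-1}\circ e_n$. Fix cofibre sequences $E_n\xrightarrow{e_n}E_{n-1}\xrightarrow{c_{n-1}}C_{n-1}\xrightarrow{\delta_{n-1}}\Sigma E_n$ and set $\theta_n=\Sigma c_{n+1}\circ\delta_n:C_n\to\Sigma C_{n+1}$. $[-,-]^*$ denotes $\mathbb{Z}$-graded morphism groups. Level $n$ detection (with respect to $X$) means that $(f_n,c_n):[X,E_n]^*\to[X,F]^*\oplus[X,C_n]^*$ is a monomorphism. $\Phi_n[X,F]^*$ is the image of $f_n:[X,E_n]^*\to[X,F]^*$; these form a decreasing filtration of $[X,F]^*$. $\mathrm{Ker}(\theta_n)$ and $\mathrm{Im}(\Sigma^{-1}\theta_{n-1})$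 are the kernel and image of the maps induced on $[X,-]^*$; both are subgroups of $[X,C_n]^*$. The first surjection is induced by $f_n$; the surjection $\mathrm{Ker}(\theta_n)\to\Phi_n[X,F]^*/\Phi_{n+1}[X,F]^*$ sends $c_n(x)$ to the class of $f_n(x)$, for $x\in[X,E_n]^*$. *)

(* Defs.v *)
From HB Require Import structures.
From mathcomp Require Import all_boot all_order all_algebra.
From mathcomp Require Import generic_quotient ring_quotient boolp.

Set Implicit Arguments.
Unset Strict Implicit.
Unset Printing Implicit Defensive.

Import GRing.Theory.
Local Open Scope ring_scope.

(** * Additive categories *)

Record preadditive := Preadditive {
  obj :> Type;
  hom : obj -> obj -> zmodType;
  idm : forall A, hom A A;
  comp : forall A B C, hom B C -> hom A B -> hom A C;
  comp1m : forall A B (f : hom A B), comp (idm B) f = f;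
  compm1 : forall A B (f : hom A B), comp f (idm A) = f;
  compA : forall A B C D (h : hom C D) (g : hom B C) (f : hom A B),
    comp h (comp g f) = comp (comp h g) f;
  compDl : forall A B C (g g' : hom B C) (f : hom A B),
    comp (g + g') f = comp g f + comp g' f;
  compDr : forall A B C (g : hom B C) (f f' : hom A B),
    comp g (f + f') = comp g f + comp g f' }.

Arguments hom {p}.
Arguments idm {p} A.
Arguments comp {p A B C}.

Notation "g \c f" := (comp g f) (at level 40, left associativity).

Section Preadditive.
Variable T : preadditive.
Implicit Types A B : T.

Definition iso A B (f : hom A B) :=
  exists g : hom B A, g \c f = idm A /\ f \c g = idm B.

Definition zero_object Z := idm Z = 0 :> @hom T Z Z.

Definition biproduct A B P :=
  exists (i : hom A P) (j : hom B P) (p : hom P A) (q : hom P B),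
    [/\ p \c i = idm A, q \c j = idm B, p \c j = 0, q \c i = 0
      & i \c p + j \c q = idm P].

End Preadditive.

(** * Triangulated categories *)

(* The suspension is given together with all its integral powers: [sh] is a
   coherent (strong monoidal) action of the group Z by additive functors,
   and the suspension is [sh 1].  The equation [i + j = k] is an argument of
   [shD] so that the coherence conditions can be stated without transport;
   as [int] has decidable equality, its proof is irrelevant. *)
Record shiftCat := ShiftCat {
  shCat :> preadditive;
  sh : int -> shCat -> shCat;
  shm : forall k (A B : shCat), hom A B -> hom (sh k A) (sh k B);
  shm1 : forall k (A : shCat), shm k (idm A) = idm (sh k A);
  shmM : forall k (A B C : shCat) (g : hom B C) (f : hom A B),
    shm k (g \c f) = shm k g \c shm k f;
  shmD : forall k (A B : shCat) (f g : hom A B),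
    shm k (f + g) = shm k f + shm k g;
  sh0 : forall A, hom (sh 0 A) A;
  sh0V : forall A, hom A (sh 0 A);
  sh0K : forall A, sh0V A \c sh0 A = idm (sh 0 A);
  sh0VK : forall A, sh0 A \c sh0V A = idm A;
  sh0_nat : forall (A B : shCat) (f : hom A B), f \c sh0 A = sh0 B \c shm 0 f;
  shD : forall i j k, i + j = k -> forall A, hom (sh i (sh j A)) (sh k A);
  shD_iso : forall i j k (e : i + j = k) A, iso (shD e A);
  shD_nat : forall i j k (e : i + j = k) (A B : shCat) (f : hom A B),
    shm k f \c shD e A = shD e B \c shm i (shm j f);
  shD0m : forall k (e : 0 + k = k) A, shD e A = sh0 (sh k A);
  shDm0 : forall k (e : k + 0 = k) A, shD e A = shm k (sh0 A);
  shDA : forall i j k ij jk ijk (e1 : j + k = jk) (e2 : i + jk = ijk)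
      (e3 : i + j = ij) (e4 : ij + k = ijk) A,
    shD e2 A \c shm i (shD e1 A) = shD e4 A \c shD e3 (sh k A) }.

Arguments sh {s}.
Arguments shm {s} k {A B}.
Arguments sh0 {s} A.
Arguments sh0V {s} A.
Arguments shD {s i j k} e A.

(* The stable homotopy category enters only through this structure, of which
   it is the motivating instance.
   [dist f g h] says that A -f-> B -g-> C -h-> Sigma A is a distinguished
   triangle (a cofibre sequence).  [dist_octahedral] is the octahedral
   axiom. *)
Record triangulated := Triangulated {
  triCat :> shiftCat;
  ex_zero : exists Z : triCat, zero_object Z;
  ex_biproduct : forall A B : triCat, exists P, biproduct A B P;
  dist : forall A B C : triCat,
    hom A B -> hom B C -> hom C (sh 1 A) -> Prop;
  dist_iso : forall (A B C A' B' C' : triCat)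
      (f : hom A B) (g : hom B C) (h : hom C (sh 1 A))
      (f' : hom A' B') (g' : hom B' C') (h' : hom C' (sh 1 A'))
      (a : hom A A') (b : hom B B') (c : hom C C'),
    iso a -> iso b -> iso c ->
    f' \c a = b \c f -> g' \c b = c \c g -> h' \c c = shm 1 a \c h ->
    dist f g h -> dist f' g' h';
  dist_id : forall A Z : triCat, zero_object Z ->
    dist (idm A) (0 : hom A Z) (0 : hom Z (sh 1 A));
  dist_ex : forall (A B : triCat) (f : hom A B),
    exists C (g : hom B C) (h : hom C (sh 1 A)), dist f g h;
  dist_rot : forall (A B C : triCat)
      (f : hom A B) (g : hom B C) (h : hom C (sh 1 A)),
    dist f g h <-> dist g h (- shm 1 f);
  dist_mor : forall (A B C A' B' C' : triCat)
      (f : hom A B) (g : hom B C) (h : hom C (sh 1 A))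
      (f' : hom A' B') (g' : hom B' C') (h' : hom C' (sh 1 A'))
      (a : hom A A') (b : hom B B'),
    dist f g h -> dist f' g' h' -> f' \c a = b \c f ->
    exists c : hom C C', g' \c b = c \c g /\ h' \c c = shm 1 a \c h;
  dist_octahedral : forall (A B C U V W : triCat)
      (f : hom A B) (f1 : hom B U) (f2 : hom U (sh 1 A))
      (g : hom B C) (g1 : hom C V) (g2 : hom V (sh 1 B))
      (h1 : hom C W) (h2 : hom W (sh 1 A)),
    dist f f1 f2 -> dist g g1 g2 -> dist (g \c f) h1 h2 ->
    exists (u : hom U W) (v : hom W V),
      [/\ dist u v (shm 1 f1 \c g2), u \c f1 = h1 \c g, h2 \c u = f2,
          v \c h1 = g1 & g2 \c v = shm 1 f \c h2] }.

(** * Graded morphism groups and graded modules *)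

(* [ghom X Y k] is [X,Y]^k. *)
Definition ghom (T : shiftCat) (X Y : T) (k : int) : zmodType :=
  hom X (sh k Y).

Definition gid (T : shiftCat) (X : T) : ghom X X 0 := sh0V X.

(* [gcomp e x a] is the composite of a : X -> Y of degree j with x : Y -> Z
   of degree k; its degree is [l = j + k]. *)
Definition gcomp (T : shiftCat) (X Y Z : T) j k l (e : j + k = l)
    (x : ghom Y Z k) (a : ghom X Y j) : ghom X Z l :=
  shD e Z \c shm j x \c a.

Arguments ghom {T}.
Arguments gid {T}.

(* Z-graded right modules over the graded ring End(X) = [X,X]^*. *)
Record gmod (T : shiftCat) (X : T) := Gmod {
  gr :> int -> zmodType;
  act : forall j k l, j + k = l -> gr k -> ghom X X j -> gr l;
  actDl : forall j k l (e : j + k = l) (x y : gr k) (a : ghom X X j),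
    act e (x + y) a = act e x a + act e y a;
  actDr : forall j k l (e : j + k = l) (x : gr k) (a b : ghom X X j),
    act e x (a + b) = act e x a + act e x b;
  act1 : forall k (e : 0 + k = k) (x : gr k), act e x (gid X) = x;
  actA : forall i j k ij jk ijk (e1 : j + k = jk) (e2 : i + jk = ijk)
      (e3 : i + j = ij) (e4 : ij + k = ijk)
      (x : gr k) (a : ghom X X j) (b : ghom X X i),
    act e2 (act e1 x a) b = act e4 x (gcomp e3 a b) }.

Arguments act {T X} g {j k l} e.

Record ghomo (T : shiftCat) (X : T) (M N : gmod X) := Ghomo {
  gfun :> forall k, {additive M k -> N k};
  gfun_act : forall j k l (e : j + k = l) (x : M k) (a : ghom X X j),
    gfun l (act M e x a) = act N e (gfun k x) a }.

Record submod (T : shiftCat) (X : T) (M : gmod X) := Submod {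
  smem : forall k, M k -> bool;
  smem0 : forall k, smem (0 : M k);
  smemB : forall k (x y : M k), smem x -> smem y -> smem (x - y);
  smem_act : forall j k l (e : j + k = l) (x : M k) (a : ghom X X j),
    smem x -> smem (act M e x a) }.

Section AdditiveHom.
Variable T : shiftCat.
Implicit Types X Y Z : T.

Lemma comp0r X Y Z (g : hom Y Z) : g \c (0 : hom X Y) = 0.
Proof. by apply: (addrI (g \c 0)); rewrite -compDr !addr0. Qed.

Lemma compNr X Y Z (g : hom Y Z) (f : hom X Y) : g \c (- f) = - (g \c f).
Proof. by apply: (addrI (g \c f)); rewrite -compDr !subrr comp0r. Qed.

Lemma compBr X Y Z (g : hom Y Z) (f f' : hom X Y) :
  g \c (f - f') = g \c f - g \c f'.
Proof. by rewrite compDr compNr. Qed.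

End AdditiveHom.

Section HomModule.
Variables (T : shiftCat) (X : T).

Section Object.
Variable Y : T.

Lemma hom_actDl j k l (e : j + k = l) (x y : ghom X Y k) (a : ghom X X j) :
  gcomp e (x + y) a = gcomp e x a + gcomp e y a.
Proof. by rewrite /gcomp shmD compDr compDl. Qed.

Lemma hom_actDr j k l (e : j + k = l) (x : ghom X Y k) (a b : ghom X X j) :
  gcomp e x (a + b) = gcomp e x a + gcomp e x b.
Proof. exact: compDr. Qed.

Lemma hom_act1 k (e : 0 + k = k) (x : ghom X Y k) : gcomp e x (gid X) = x.
Proof.
by rewrite /gcomp shD0m -sh0_nat -compA sh0VK compm1.
Qed.

Lemma hom_actA i j k ij jk ijk (e1 : j + k = jk) (e2 : i + jk = ijk)
    (e3 : i + j = ij) (e4 : ij + k = ijk)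
    (x : ghom X Y k) (a : ghom X X j) (b : ghom X X i) :
  gcomp e2 (gcomp e1 x a) b = gcomp e4 x (gcomp e3 a b).
Proof.
rewrite /gcomp !shmM !compA (shDA e1 e2 e3 e4).
by rewrite -(compA (shD e4 Y) (shm ij x)) shD_nat !compA.
Qed.

(* The End(X)-module [X,Y]^*. *)
Definition homgm : gmod X := Gmod hom_actDl hom_actDr hom_act1 hom_actA.

End Object.

Section Map.
Variables (Y Z : T) (f : hom Y Z).

Definition hom_map k (x : ghom X Y k) : ghom X Z k := shm k f \c x.

Lemma hom_map_additive k : zmod_morphism (@hom_map k).
Proof. by move=> x y; apply: compBr. Qed.

HB.instance Definition _ k := GRing.isZmodMorphism.Build
  (ghom X Y k) (ghom X Z k) (@hom_map k) (@hom_map_additive k).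

Lemma hom_map_act j k l (e : j + k = l) (x : ghom X Y k) (a : ghom X X j) :
  hom_map (gcomp e x a) = gcomp e (hom_map x) a.
Proof. by rewrite /hom_map /gcomp shmM !compA shD_nat. Qed.

(* The map f_* : [X,Y]^* -> [X,Z]^* induced by f : Y -> Z. *)
Definition push : ghomo (homgm Y) (homgm Z) :=
  @Ghomo _ _ (homgm Y) (homgm Z)
    (fun k => @hom_map k : {additive ghom X Y k -> ghom X Z k}) hom_map_act.

End Map.
End HomModule.

Arguments homgm {T}.
Arguments push {T} X {Y Z}.

Section SubQuotient.
Variables (T : shiftCat) (X : T).

Lemma act0l (M : gmod X) j k l (e : j + k = l) (a : ghom X X j) :
  act M e 0 a = 0.
Proof. by apply: (addrI (act M e 0 a)); rewrite -actDl !addr0. Qed.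

Lemma actNl (M : gmod X) j k l (e : j + k = l) (x : M k) (a : ghom X X j) :
  act M e (- x) a = - act M e x a.
Proof. by apply: (addrI (act M e x a)); rewrite -actDl !subrr act0l. Qed.

Section Sub.
Variables (M : gmod X) (A : submod M).

Lemma smem_closed k : zmod_closed (@smem _ _ _ A k).
Proof. by split=> [|x y]; [apply: smem0 | apply: smemB]. Qed.

HB.instance Definition _ k :=
  GRing.isZmodClosed.Build (M k) (@smem _ _ _ A k) (@smem_closed k).

Record sub_gr k := SubGr { sub_val : M k; sub_valP : @smem _ _ _ A k sub_val }.

HB.instance Definition _ k := [isSub for @sub_val k].
HB.instance Definition _ k := [Choice of sub_gr k by <:].
HB.instance Definition _ k := [SubChoice_isSubZmodule of sub_gr k by <:].

Definition sub_act j k l (e : j + k = l) (x : sub_gr k) (a : ghom X X j) :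
  sub_gr l := @SubGr l (act M e (val x) a) (smem_act e a (valP x)).

Lemma sub_actDl j k l (e : j + k = l) (x y : sub_gr k) (a : ghom X X j) :
  sub_act e (x + y) a = sub_act e x a + sub_act e y a.
Proof. by apply: val_inj; exact: actDl. Qed.

Lemma sub_actDr j k l (e : j + k = l) (x : sub_gr k) (a b : ghom X X j) :
  sub_act e x (a + b) = sub_act e x a + sub_act e x b.
Proof. by apply: val_inj; exact: actDr. Qed.

Lemma sub_act1 k (e : 0 + k = k) (x : sub_gr k) : sub_act e x (gid X) = x.
Proof. by apply: val_inj; rewrite /= act1. Qed.

Lemma sub_actA i j k ij jk ijk (e1 : j + k = jk) (e2 : i + jk = ijk)
    (e3 : i + j = ij) (e4 : ij + k = ijk)
    (x : sub_gr k) (a : ghom X X j) (b : ghom X X i) :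
  sub_act e2 (sub_act e1 x a) b = sub_act e4 x (gcomp e3 a b).
Proof. by apply: val_inj; rewrite /= (actA e1 e2 e3 e4). Qed.

Definition subgm : gmod X := Gmod sub_actDl sub_actDr sub_act1 sub_actA.

End Sub.

Section Quot.
Variables (M : gmod X) (A : submod M).

Definition quot_gr k : zmodType :=
  Quotient.quot (GRing.ZmodClosed.clone (M k) (@smem _ _ _ A k) _).

Definition quot_pi k (x : M k) : quot_gr k := (\pi x)%qT.

Lemma quot_pi_additive k : zmod_morphism (@quot_pi k).
Proof. exact: raddfB. Qed.

HB.instance Definition _ k := GRing.isZmodMorphism.Build
  (M k) (quot_gr k) (@quot_pi k) (@quot_pi_additive k).

Lemma quot_piP k (x y : M k) : quot_pi x = quot_pi y <-> smem A (x - y).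
Proof.
pose I := GRing.ZmodClosed.clone (M k) (@smem _ _ _ A k) _.
have E : smem A (x - y) = (x == y %[mod Quotient.quot I])%qT.
  exact: (Quotient.idealrBE I).
by rewrite E; split=> /eqP.
Qed.

Definition quot_act j k l (e : j + k = l) (x : quot_gr k) (a : ghom X X j) :
  quot_gr l := quot_pi (act M e (repr x) a).

Lemma quot_act_pi j k l (e : j + k = l) (x : M k) (a : ghom X X j) :
  quot_act e (quot_pi x) a = quot_pi (act M e x a).
Proof.
apply/quot_piP; rewrite -actNl -actDl; apply/smem_act/quot_piP.
exact: reprK.
Qed.

Lemma quot_pi_ex k (q : quot_gr k) : exists x : M k, q = quot_pi x.
Proof. by exists (repr q); rewrite /quot_pi reprK. Qed.

Lemma quot_actDl j k l (e : j + k = l) (x y : quot_gr k) (a : ghom X X j) :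
  quot_act e (x + y) a = quot_act e x a + quot_act e y a.
Proof.
have [[u ->] [v ->]] := (quot_pi_ex x, quot_pi_ex y).
by rewrite -raddfD !quot_act_pi actDl raddfD.
Qed.

Lemma quot_actDr j k l (e : j + k = l) (x : quot_gr k) (a b : ghom X X j) :
  quot_act e x (a + b) = quot_act e x a + quot_act e x b.
Proof.
by have [u ->] := quot_pi_ex x; rewrite !quot_act_pi actDr raddfD.
Qed.

Lemma quot_act1 k (e : 0 + k = k) (x : quot_gr k) : quot_act e x (gid X) = x.
Proof. by have [u ->] := quot_pi_ex x; rewrite quot_act_pi act1. Qed.

Lemma quot_actA i j k ij jk ijk (e1 : j + k = jk) (e2 : i + jk = ijk)
    (e3 : i + j = ij) (e4 : ij + k = ijk)
    (x : quot_gr k) (a : ghom X X j) (b : ghom X X i) :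
  quot_act e2 (quot_act e1 x a) b = quot_act e4 x (gcomp e3 a b).
Proof.
by have [u ->] := quot_pi_ex x; rewrite !quot_act_pi (actA e1 e2 e3 e4).
Qed.

Definition quotgm : gmod X :=
  Gmod quot_actDl quot_actDr quot_act1 quot_actA.

Lemma quot_proj_act j k l (e : j + k = l) (x : M k) (a : ghom X X j) :
  quot_pi (act M e x a) = quot_act e (quot_pi x) a.
Proof. by rewrite quot_act_pi. Qed.

Definition quot_proj : ghomo M quotgm :=
  @Ghomo _ _ M quotgm (fun k => @quot_pi k : {additive M k -> quot_gr k})
    quot_proj_act.

End Quot.

(* B viewed inside A; as B is only required to be a submodule of M, this is
   A :&: B.  It is used for B contained in A. *)
Section Within.
Variables (M : gmod X) (A B : submod M).

Definition within_mem k (x : subgm A k) := smem B (val x).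

Lemma within0 k : within_mem (0 : subgm A k).
Proof. by rewrite /within_mem raddf0 smem0. Qed.

Lemma withinB k (x y : subgm A k) :
  within_mem x -> within_mem y -> within_mem (x - y).
Proof. by rewrite /within_mem raddfB; apply: smemB. Qed.

Lemma within_act j k l (e : j + k = l) (x : subgm A k) (a : ghom X X j) :
  within_mem x -> within_mem (act (subgm A) e x a).
Proof. exact: smem_act. Qed.

Definition within : submod (subgm A) := Submod within0 withinB within_act.

End Within.

Section KerIm.
Variables (M N : gmod X) (f : ghomo M N).

Definition ker_mem k (x : M k) := f k x == 0.

Lemma ker0 k : ker_mem (0 : M k).
Proof. by rewrite /ker_mem raddf0. Qed.

Lemma kerB k (x y : M k) : ker_mem x -> ker_mem y -> ker_mem (x - y).
Proof. by rewrite /ker_mem raddfB => /eqP-> /eqP->; rewrite subr0. Qed.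

Lemma ker_act j k l (e : j + k = l) (x : M k) (a : ghom X X j) :
  ker_mem x -> ker_mem (act M e x a).
Proof. by rewrite /ker_mem gfun_act => /eqP->; rewrite act0l. Qed.

Definition ker : submod M := Submod ker0 kerB ker_act.

Definition im_mem k (y : N k) := `[< exists x : M k, f k x = y >].

Lemma im0 k : im_mem (0 : N k).
Proof. by apply/asboolP; exists 0; rewrite raddf0. Qed.

Lemma imB k (x y : N k) : im_mem x -> im_mem y -> im_mem (x - y).
Proof.
move=> /asboolP[u <-] /asboolP[v <-]; apply/asboolP.
by exists (u - v); rewrite raddfB.
Qed.

Lemma im_act j k l (e : j + k = l) (y : N k) (a : ghom X X j) :
  im_mem y -> im_mem (act N e y a).
Proof.
by move=> /asboolP[u <-]; apply/asboolP; exists (act M e u a); rewrite gfun_act.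
Qed.

Definition im : submod N := Submod im0 imB im_act.

Lemma im_memf k (x : M k) : smem im (f k x).
Proof. by apply/asboolP; exists x. Qed.

Definition corestr_fun k (x : M k) : subgm im k := @SubGr _ im k (f k x) (im_memf x).

Lemma corestr_additive k : zmod_morphism (@corestr_fun k).
Proof. by move=> x y; apply: val_inj; rewrite raddfB /= raddfB. Qed.

HB.instance Definition _ k := GRing.isZmodMorphism.Build
  (M k) (subgm im k) (@corestr_fun k) (@corestr_additive k).

Lemma corestr_act j k l (e : j + k = l) (x : M k) (a : ghom X X j) :
  corestr_fun (act M e x a) = act (subgm im) e (corestr_fun x) a.
Proof. by apply: val_inj; rewrite /= gfun_act. Qed.

(* f as a map onto its image. *)
Definition corestr : ghomo M (subgm im) :=
  @Ghomo _ _ M (subgm im)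
    (fun k => @corestr_fun k : {additive M k -> subgm im k}) corestr_act.

End KerIm.
End SubQuotient.

Definition short_exact (T : shiftCat) (X : T) (L M N : gmod X)
    (i : ghomo L M) (p : ghomo M N) :=
  forall k,
    [/\ injective (i k),
        forall y, p k y = 0 <-> exists x, i k x = y
      & forall z, exists y, p k y = z].

(* (P, a, b) is the pullback of p and q: the square commutes and P maps
   isomorphically onto the fibre product of M and N over Q. *)
Definition is_pullback (T : shiftCat) (X : T) (P M N Q : gmod X)
    (a : ghomo P M) (b : ghomo P N) (p : ghomo M Q) (q : ghomo N Q) :=
  forall k,
    (forall x, p k (a k x) = q k (b k x)) /\
    (forall y z, p k y = q k z -> exists! x, a k x = y /\ b k x = z).

(** * Towers *)

(* [tw_e h] is e_m : E_m -> E_n, for m = n + 1. *)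
Record tower (T : triangulated) (F : T) := Tower {
  tw_E :> int -> T;
  tw_e : forall m n, m = n + 1 -> hom (tw_E m) (tw_E n);
  tw_f : forall n, hom (tw_E n) F;
  tw_fe : forall m n (h : m = n + 1), tw_f m = tw_f n \c tw_e h }.

Arguments tw_e {T F} t {m n} h.
Arguments tw_f {T F} t n.

(* The chosen cofibre sequences E_m -> E_n -> C_n -> Sigma E_m, m = n + 1. *)
Record cofibres (T : triangulated) (F : T) (E : tower F) := Cofibres {
  cf_C :> int -> T;
  cf_c : forall n, hom (E n) (cf_C n);
  cf_delta : forall m n, m = n + 1 -> hom (cf_C n) (sh 1 (E m));
  cf_dist : forall m n (h : m = n + 1),
    dist (tw_e E h) (cf_c n) (cf_delta h) }.

Arguments cf_c {T F E} c n.
Arguments cf_delta {T F E} c {m n} h.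

Section Tower.
Variables (T : triangulated) (F : T) (E : tower F) (C : cofibres E).

(* theta_n : C_n -> Sigma C_m, for m = n + 1. *)
Definition theta m n (h : m = n + 1) : hom (C n) (sh 1 (C m)) :=
  shm 1 (cf_c C m) \c cf_delta C h.

(* Sigma^-1 theta_n : Sigma^-1 C_n -> C_m, for m = n + 1, using the canonical
   isomorphism Sigma^-1 Sigma C_m = C_m. *)
Definition desusp_theta m n (h : m = n + 1) : hom (sh (-1) (C n)) (C m) :=
  sh0 (C m) \c shD (addNr 1) (C m) \c shm (-1) (theta h).

Variable X : T.

Definition detection (n : int) := forall k : int,
  injective (fun x : homgm X (E n) k =>
    (push X (tw_f E n) k x, push X (cf_c C n) k x)).

Definition Phi (n : int) : submod (homgm X F) := im (push X (tw_f E n)).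

Lemma Phi_decr n k (x : homgm X F k) : smem (Phi (n + 1)) x -> smem (Phi n) x.
Proof.
move=> /asboolP[y <-]; apply/asboolP.
exists (push X (tw_e E (erefl (n + 1))) k y).
by rewrite /= /hom_map compA -shmM -tw_fe.
Qed.

Definition gr_Phi (n : int) : gmod X :=
  quotgm (within (Phi n) (Phi (n + 1))).

Definition gr_Phi_proj (n : int) : ghomo (subgm (Phi n)) (gr_Phi n) :=
  quot_proj (within (Phi n) (Phi (n + 1))).

Definition ker_theta (n : int) : submod (homgm X (C n)) :=
  ker (push X (theta (erefl (n + 1)))).

(* Im(Sigma^-1 theta_(n-1)) inside [X,C_n]^*. *)
Definition im_theta (n : int) : submod (homgm X (C n)) :=
  im (push X (desusp_theta (esym (subrK 1 n)))).

End Tower.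

Arguments detection {T F E} C X n.
Arguments Phi {T F} E X n.
Arguments gr_Phi {T F} E X n.
Arguments gr_Phi_proj {T F} E X n.
Arguments ker_theta {T F E} C X n.
Arguments im_theta {T F E} C X n.

(* Main.v *)
(** Detection at level [n + 1] makes [c_n : [X,E_n]^* -> Ker theta_n]
    surjective: if [theta_n u = 0] then [delta_n u] is killed by
    [Sigma c_(n+1)], and by [Sigma f_(n+1) = Sigma f_n o Sigma e_(n+1)], so
    [delta_n u = 0] and [u] lifts.  Detection at level [n - 1] and
    [c_(n-1) o e_n = 0] show that [e_n] vanishes on [Ker f_n], so that [Ker f_n]
    is the image of [Sigma^-1 delta_(n-1)].  Detection at level [n] makes [c_n]
    injective on [Ker f_n], which it therefore maps isomorphically onto
    [Im (Sigma^-1 theta_(n-1))].  Since [Ker c_n] is the image of [e_(n+1)],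
    [f_n] maps it onto [Phi_(n+1)], and a diagram chase concludes. *)
From HB Require Import structures.
From mathcomp Require Import all_boot all_algebra boolp.
Require Import Defs.

Set Implicit Arguments.
Unset Strict Implicit.
Unset Printing Implicit Defensive.

Import GRing.Theory.
Local Open Scope ring_scope.

(* Locked because rewriting with [compA] would otherwise unfold it. *)
HB.lock Definition shK (T : shiftCat) (i j : int) (e : i + j = 0) (A : T) :
  hom (sh i (sh j A)) A := sh0 A \c shD e A.

(** * Weak kernels and their behaviour under shifts *)

Section Exactness.
Variable T : shiftCat.
Implicit Types A B C X : T.

Lemma comp0l A B C (f : hom A B) : (0 : hom B C) \c f = 0.
Proof. by apply: (addrI (0 \c f)); rewrite -compDl !addr0. Qed.

Lemma compNl A B C (g : hom B C) (f : hom A B) : (- g) \c f = - (g \c f).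
Proof. by apply: (addrI (g \c f)); rewrite -compDl !subrr comp0l. Qed.

Lemma shm0 k A B : shm k (0 : hom A B) = 0.
Proof. by apply: (addrI (shm k 0)); rewrite -shmD !addr0. Qed.

Lemma iso_comp A B C (g : hom B C) (f : hom A B) :
  iso g -> iso f -> iso (g \c f).
Proof.
move=> [g' [g'g gg']] [f' [f'f ff']]; exists (f' \c g'); split.
  by rewrite compA -(compA f') g'g compm1.
by rewrite compA -(compA g) ff' compm1.
Qed.

Lemma iso_comp_eq0 A B C (g : hom B C) (f : hom A B) :
  iso g -> g \c f = 0 -> f = 0.
Proof.
by move=> [g' [g'g _]] gf0; rewrite -[f]comp1m -g'g -compA gf0 comp0r.
Qed.

(** The part of a triangle used below: exactness after applying [hom X -], with no uniqueness of
    lifts. *)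
Definition weak_kernel A B C (f : hom A B) (g : hom B C) :=
  g \c f = 0 /\
  forall X (y : hom X B), g \c y = 0 -> exists x : hom X A, f \c x = y.

Lemma shK_iso i j (e : i + j = 0) A : iso (shK e A).
Proof.
rewrite unlock; apply: iso_comp (shD_iso e A).
by exists (sh0V A); rewrite sh0K sh0VK.
Qed.

Lemma shK_nat i j (e : i + j = 0) A B (f : hom A B) :
  f \c shK e A = shK e B \c shm i (shm j f).
Proof. by rewrite unlock compA sh0_nat -!compA shD_nat. Qed.

(* A triangle identity of the adjoint equivalence of [sh i] and [sh j]. *)
Lemma shm_shK i j (e : j + i = 0) (e' : i + j = 0) A :
  shm i (shK e A) = shK e' (sh i A).
Proof.
rewrite unlock shmM -(shDm0 (addr0 i)) -(shD0m (add0r i)).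
exact: (shDA e (addr0 i) e' (add0r i)).
Qed.

(** Conjugating [shm (- k) z] by the natural isomorphism [shK] from [sh (- k) (sh k _)] to the
    identity desuspends [z]. *)
Lemma shm_lift k A B X (f : hom A B) (y : hom X B)
    (z : hom (sh k X) (sh k A)) :
  shm k f \c z = shm k y -> exists x, f \c x = y.
Proof.
move=> fz; have [v [_ Kv]] := shK_iso (addNr k) X.
exists (shK (addNr k) A \c shm (- k) z \c v).
rewrite !compA shK_nat -(compA _ _ (shm (- k) z)) -shmM fz -shK_nat.
by rewrite -compA Kv compm1.
Qed.

(** By adjunction [y : X -> sh k B] corresponds to a map [sh (- k) X -> B]; its lift is transported
    back, and the triangle identity recovers [y]. *)
Lemma shm_weak_kernel k A B C (f : hom A B) (g : hom B C) :
  weak_kernel f g -> weak_kernel (shm k f) (shm k g).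
Proof.
move=> [gf0 fP]; split=> [|X y gy0]; first by rewrite -shmM gf0 shm0.
have [|x fx] := fP _ (shK (addNr k) B \c shm (- k) y).
  by rewrite compA shK_nat -compA -shmM gy0 shm0 comp0r.
have [v [_ Kv]] := shK_iso (subrr k) X; exists (shm k x \c v).
rewrite compA -shmM fx shmM (shm_shK (addNr k) (subrr k)) -shK_nat.
by rewrite -compA Kv compm1.
Qed.

(** Shift by [-1], then identify [sh (-1) (sh 1 _)] with the identity through [shK]. *)
Lemma desusp_weak_kernel A B C (f : hom C (sh 1 A)) (g : hom A B) :
  weak_kernel f (shm 1 g) ->
  weak_kernel (shK (addNr 1) A \c shm (-1) f) g.
Proof.
move=> /(shm_weak_kernel (-1))[gf0 fP]; split=> [|X y gy0].
  by rewrite compA shK_nat -compA gf0 comp0r.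
have [v [_ Kv]] := shK_iso (addNr 1) A.
have [|x fx] := fP _ (v \c y); last first.
  by exists x; rewrite -compA fx compA Kv comp1m.
apply: (iso_comp_eq0 (shK_iso (addNr 1) B)).
by rewrite compA -shK_nat compA -(compA g) Kv compm1.
Qed.

End Exactness.

(** * Exactness of distinguished triangles *)

Section Triangles.
Variable T : triangulated.
Implicit Types A B C : T.

(** The triangle of [idm A] maps to the given one by [idm A] and [f], so [g \c f] factors through a
    zero object. *)
Lemma dist_comp0 A B C (f : hom A B) (g : hom B C) (h : hom C (sh 1 A)) :
  dist f g h -> g \c f = 0.
Proof.
move=> dfg; have [Z Z0] := ex_zero T.
have [|c [-> _]] := dist_mor (b := f) (dist_id A Z0) dfg (a := idm A) _.
  by [].
by rewrite comp0r.
Qed.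

(** Rotate both triangles, that of [idm X] and the given one, and extend [y : X -> B] and
    [0 : Z -> C] to a map between them; its third component [sh 1 X -> sh 1 A] desuspends to the
    lift. *)
Lemma dist_weak_kernel A B C (f : hom A B) (g : hom B C) (h : hom C (sh 1 A)) :
  dist f g h -> weak_kernel f g.
Proof.
move=> dfg; split=> [|X y gy0]; first exact: dist_comp0 dfg.
have [Z Z0] := ex_zero T.
have dX := (dist_rot _ _ _).1 (dist_id X Z0).
have [|c [_ fc]] := dist_mor (a := y) (b := 0) dX ((dist_rot _ _ _).1 dfg) _.
  by rewrite gy0 comp0l.
apply: (shm_lift (k := 1) (z := c)); apply: oppr_inj.
by rewrite -compNl fc shm1 compNr compm1.
Qed.

Lemma dist_weak_kernel2 A B C (f : hom A B) (g : hom B C) (h : hom C (sh 1 A)) :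
  dist f g h -> weak_kernel g h.
Proof. by move=> /dist_rot/dist_weak_kernel. Qed.

Lemma dist_weak_kernel3 A B C (f : hom A B) (g : hom B C) (h : hom C (sh 1 A)) :
  dist f g h -> weak_kernel h (shm 1 f).
Proof.
move=> /dist_rot/dist_weak_kernel2[fh0 hP].
split=> [|X y fy0]; first by apply: oppr_inj; rewrite -compNl fh0 oppr0.
by apply: hP; rewrite compNl fy0 oppr0.
Qed.

End Triangles.

(** * Construction of maps of graded [End(X)]-modules *)

Section GradedModules.
Variables (T : shiftCat) (X : T).
Implicit Types L M N : gmod X.

Lemma ghomo_lift M N (A : submod N) (f : ghomo M N) :
  (forall k x, smem A (f k x)) ->
  exists g : ghomo M (subgm A), forall k x, sub_val (g k x) = f k x.
Proof.
move=> fA; pose g k x : subgm A k := SubGr (fA k x).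
have gB k : zmod_morphism (@g k).
  by move=> x y; apply: val_inj; rewrite raddfB /= raddfB.
have gZ j k l (e : j + k = l) (x : M k) a :
    g l (act M e x a) = act (subgm A) e (g k x) a.
  by apply: val_inj; rewrite /= gfun_act.
pose ga k : {additive M k -> subgm A k} :=
  HB.pack (@g k) (GRing.isZmodMorphism.Build _ _ (@g k) (gB k)).
by exists (@Ghomo _ _ M (subgm A) ga gZ).
Qed.

Lemma ghomo_comp L M N (g : ghomo M N) (f : ghomo L M) :
  exists h : ghomo L N, forall k x, h k x = g k (f k x).
Proof.
pose h k x := g k (f k x).
have hB k : zmod_morphism (@h k) by move=> x y; rewrite /h !raddfB.
have hZ j k l (e : j + k = l) (x : L k) a :
    h l (act L e x a) = act N e (h k x) a.
  by rewrite /h !gfun_act.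
pose ha k : {additive L k -> N k} :=
  HB.pack (@h k) (GRing.isZmodMorphism.Build _ _ (@h k) (hB k)).
by exists (@Ghomo _ _ L N ha hZ).
Qed.

(** Chosen preimages define [p]; the kernel condition makes its values independent of the choice,
    whence additivity and linearity. *)
Lemma ghomo_factor L M N (c : ghomo L M) (g : ghomo L N) :
  (forall k y, exists x, c k x = y) ->
  (forall k x, c k x = 0 -> g k x = 0) ->
  exists p : ghomo M N, forall k x, p k (c k x) = g k x.
Proof.
move=> cP cg; pose s k (y : M k) := sval (cid (cP k y)).
have sK k y : c k (s k y) = y by rewrite /s; case: cid.
pose p k y := g k (s k y).
have pc k x : p k (c k x) = g k x.
  by apply/eqP; rewrite -subr_eq0 -raddfB cg // raddfB sK subrr.
have pB k : zmod_morphism (@p k).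
  by move=> x y; rewrite -[x]sK -[y]sK -raddfB !pc raddfB.
have pZ j k l (e : j + k = l) (x : M k) a :
    p l (act M e x a) = act N e (p k x) a.
  by rewrite -[x]sK -gfun_act !pc gfun_act.
pose pa k : {additive M k -> N k} :=
  HB.pack (@p k) (GRing.isZmodMorphism.Build _ _ (@p k) (pB k)).
by exists (@Ghomo _ _ M N pa pZ).
Qed.

Lemma corestr_surj M N (f : ghomo M N) k (y : subgm (im f) k) :
  exists x, corestr f k x = y.
Proof. by case: y => y /[dup] /asboolP[x <-] yP; exists x; apply: val_inj. Qed.

Lemma weak_kernel_push A B C (f : hom A B) (g : hom B C) k (y : homgm X B k) :
  weak_kernel f g -> push X g k y = 0 <-> exists x, push X f k x = y.
Proof.
move=> /(shm_weak_kernel k)[gf0 fP]; split=> [/fP //|[x <-]].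
by rewrite /= /hom_map compA gf0 comp0l.
Qed.

Lemma push_comp A B C (g : hom B C) (f : hom A B) k (x : homgm X A k) :
  push X (g \c f) k x = push X g k (push X f k x).
Proof. by rewrite /= /hom_map shmM compA. Qed.

End GradedModules.

(** * Consequences of detection for the tower *)

Section Detection.
Variables (T : triangulated) (F : T) (E : tower F) (C : cofibres E) (X : T).

Lemma detection_eq0 n k (x : homgm X (E n) k) : detection C X n ->
  push X (tw_f E n) k x = 0 -> push X (cf_c C n) k x = 0 -> x = 0.
Proof. by move=> det fx cx; apply: (det k); rewrite fx cx !raddf0. Qed.

(** Through [sh k (sh 1 _) = sh (k + 1) _], up to isomorphism, this is detection one degree
    higher. *)
Lemma detection_susp_eq0 n k (x : homgm X (sh 1 (E n)) k) : detection C X n ->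
  push X (shm 1 (tw_f E n)) k x = 0 -> push X (shm 1 (cf_c C n)) k x = 0 ->
  x = 0.
Proof.
move=> det fx cx.
rewrite /= /hom_map in fx cx.
apply: (iso_comp_eq0 (shD_iso (erefl (k + 1)) (E n))).
by apply: (detection_eq0 det);
  rewrite /= /hom_map compA shD_nat -compA ?fx ?cx comp0r.
Qed.

Section Step.
Variables (m n : int) (h : m = n + 1).

Lemma theta_cf_c : theta C h \c cf_c C n = 0.
Proof.
have [d0 _] := dist_weak_kernel2 (cf_dist C h).
by rewrite /theta -compA d0 comp0r.
Qed.

Lemma ker_cf_c k (x : homgm X (E n) k) :
  push X (cf_c C n) k x = 0 <-> exists y, push X (tw_e E h) k y = x.
Proof. exact/weak_kernel_push/dist_weak_kernel/cf_dist. Qed.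

Lemma ker_theta_lift k (u : homgm X (C n) k) : detection C X m ->
  push X (theta C h) k u = 0 -> exists x, push X (cf_c C n) k x = u.
Proof.
move=> det; rewrite push_comp => cu0.
apply/(weak_kernel_push _ (dist_weak_kernel2 (cf_dist C h))).
apply: detection_susp_eq0 det _ cu0.
have [e0 _] := dist_weak_kernel3 (cf_dist C h).
by rewrite -push_comp (tw_fe E h) shmM -compA e0 comp0r /= /hom_map shm0 comp0l.
Qed.

Definition desusp_delta : hom (sh (-1) (C n)) (E m) :=
  shK (addNr 1) (E m) \c shm (-1) (cf_delta C h).

(** Hence [c_m] carries the image of [Sigma^-1 delta_n] onto that of [Sigma^-1 theta_n]. *)
Lemma desusp_thetaE : desusp_theta C h = cf_c C m \c desusp_delta.
Proof.
rewrite /desusp_delta compA shK_nat /desusp_theta /theta shmM.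
by rewrite unlock !compA.
Qed.

Lemma ker_tw_e k (x : homgm X (E m) k) :
  push X (tw_e E h) k x = 0 <-> exists w, push X desusp_delta k w = x.
Proof.
exact/weak_kernel_push/desusp_weak_kernel/dist_weak_kernel3/cf_dist.
Qed.

Lemma ker_tw_f k (x : homgm X (E m) k) : detection C X n ->
  push X (tw_f E m) k x = 0 <-> exists w, push X desusp_delta k w = x.
Proof.
move=> det; split=> [fx|/ker_tw_e ex]; last first.
  by rewrite (tw_fe E h) push_comp ex raddf0.
apply/ker_tw_e/(detection_eq0 det); first by rewrite -push_comp -tw_fe.
by apply/ker_cf_c; exists x.
Qed.

End Step.
End Detection.

(** * The two sequences and the pullback square; naturality is the [End(X)]-linearity built into
    [ghomo] *)

Theorem theorem2p10 (T : triangulated) (F : T) (E : tower F) (C : cofibres E)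
    (X : T) (hdet : forall n : int, detection C X n) (n : int) :
  exists (i : ghomo (subgm (im_theta C X n)) (homgm X (E n)))
         (j : ghomo (subgm (im_theta C X n)) (subgm (ker_theta C X n)))
         (c : ghomo (homgm X (E n)) (subgm (ker_theta C X n)))
         (p : ghomo (subgm (ker_theta C X n)) (gr_Phi E X n)),
    let f : ghomo (homgm X (E n)) (subgm (Phi E X n)) :=
      corestr (push X (tw_f E n)) in
    let q : ghomo (subgm (Phi E X n)) (gr_Phi E X n) := gr_Phi_proj E X n in
    (forall (k : int) (u : subgm (im_theta C X n) k),
       sub_val (j k u) = sub_val u) /\
    (forall (k : int) (x : homgm X (E n) k),
       sub_val (c k x) = push X (cf_c C n) k x) /\
    (forall (k : int) (x : homgm X (E n) k), p k (c k x) = q k (f k x)) /\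
    short_exact i f /\
    short_exact j p /\
    is_pullback c f p q /\
    (forall (k : int) (u : subgm (im_theta C X n) k), c k (i k u) = j k u).
Proof.
set f := corestr _; set q := gr_Phi_proj E X n.
(* [h] indexes the step from level [n + 1] to [n], [h'] the step from [n] to [n - 1]. *)
pose h := erefl (n + 1); pose h' := esym (subrK 1 n).
have fE k x : sub_val (f k x) = push X (tw_f E n) k x by [].
have [c cE] : exists c : ghomo (homgm X (E n)) (subgm (ker_theta C X n)),
    forall k x, sub_val (c k x) = push X (cf_c C n) k x.
  apply: ghomo_lift => k x; apply/eqP.
  by rewrite -push_comp theta_cf_c /= /hom_map shm0 comp0l.
have c_surj k u : exists x, c k x = u.
  case: u => u uP; have [x xu] := ker_theta_lift (hdet _) (eqP uP).
  by exists x; apply: val_inj; rewrite /= cE.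
have c_eq0 k x : c k x = 0 <-> exists y, push X (tw_e E h) k y = x.
  by rewrite -(ker_cf_c C) -cE; split=> [->|cx] //; apply: val_inj.
have f_eq0 k x : f k x = 0 <-> push X (tw_f E n) k x = 0.
  by rewrite -fE; split=> [->|fx] //; apply: val_inj.
have cf_inj k x y : c k x = c k y -> f k x = f k y -> x = y.
  by move=> cxy fxy; apply: (hdet n k); rewrite -!fE -!cE cxy fxy.
(* As [f_(n+1) = f_n o e_(n+1)], the kernel of [q] is the image under [f_n] of
   [Im e_(n+1) = Ker c_n]. *)
have q_eq0 k z : q k z = 0 <->
    exists y, sub_val z = push X (tw_f E n) k (push X (tw_e E h) k y).
  rewrite -[0](raddf0 (q k)) quot_piP subr0; split=> [/asboolP[y yz]|[y zE]].
    by exists y; rewrite -push_comp -tw_fe.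
  by apply/asboolP; exists y; rewrite /= zE -push_comp -tw_fe.
have [qf qfE] := ghomo_comp q f.
(* Factor [q o f] through the surjection [c], whose kernel [f] sends into [Phi_(n+1)]. *)
have [p pE] : exists p : ghomo (subgm (ker_theta C X n)) (gr_Phi E X n),
    forall k x, p k (c k x) = qf k x.
  apply: ghomo_factor c_surj _ => k x /c_eq0[y <-].
  by rewrite qfE; apply/q_eq0; exists y.
have {qf qfE} pE k x : p k (c k x) = q k (f k x) by rewrite pE qfE.
have fd k w : f k (push X (desusp_delta C h') k w) = 0.
  by apply/f_eq0/(ker_tw_f h' _ (hdet _)); exists w.
have cd k w : sub_val (c k (push X (desusp_delta C h') k w)) =
    push X (desusp_theta C h') k w.
  by rewrite cE -push_comp -desusp_thetaE.
pose r := corestr (push X (desusp_theta C h')).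
(* [i] inverts [c_n] on [Ker f_n], sending [Sigma^-1 theta w] to [Sigma^-1 delta w]; detection at
   level [n] makes this well defined. *)
have [i iE] : exists i : ghomo (subgm (im_theta C X n)) (homgm X (E n)),
    forall k w, i k (r k w) = push X (desusp_delta C h') k w.
  apply: ghomo_factor (@corestr_surj _ _ _ _ _) _ => k w rw0.
  apply: cf_inj; last by rewrite fd raddf0.
  by apply: val_inj; rewrite /= cd raddf0; exact: (congr1 val rw0).
have ci k u : sub_val (c k (i k u)) = sub_val u.
  by have [w <-] := corestr_surj u; rewrite iE cd.
have fi k u : f k (i k u) = 0.
  by have [w <-] := corestr_surj u; rewrite iE fd.
have f_ker k x : f k x = 0 -> exists u, i k u = x.
  by move=> /f_eq0/(ker_tw_f h' _ (hdet _))[w <-]; exists (r k w); rewrite iE.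
have [j jE] := ghomo_comp c i.
exists i, j, c, p; split=> [k u|]; first by rewrite jE.
split=> //; split=> //.
have i_inj k : injective (i k).
  by move=> u v uv; apply: val_inj; rewrite /= -!ci uv.
split=> [k|].
  split=> [||z]; [exact: i_inj| | exact: corestr_surj].
  by move=> x; split=> [/f_ker //|[u <-]].
(* Here [f x - z] is some [f_n (e_(n+1) y)]; subtracting [e_(n+1) y] from [x] corrects [f x] to [z]
   and keeps [c x]. *)
have lift_fibre k x z : p k (c k x) = q k z ->
    exists y, c k y = c k x /\ f k y = z.
  rewrite pE => /eqP; rewrite -subr_eq0 -raddfB => /eqP/q_eq0[y yE].
  exists (x - push X (tw_e E h) k y); split.
    rewrite raddfB (_ : c k (push _ _ _ _) = 0) ?subr0 //.
    by apply/c_eq0; exists y.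
  rewrite raddfB (_ : f k (push _ _ _ _) = f k x - z) ?subKr //.
  by apply: val_inj; rewrite [RHS]yE.
split=> [k|].
  split=> [u v||z].
  - by rewrite !jE => uv; apply: val_inj; rewrite /= -!ci uv.
  - move=> u; split=> [pu0|[v <-]]; last by rewrite jE pE fi raddf0.
    have [x cx] := c_surj k u.
    (* The case [z = 0] moves the preimage of [u] into [Ker f], which is the image of [i]. *)
    have [|y [cy fy]] := lift_fibre k x 0; first by rewrite cx pu0 raddf0.
    by have [v vy] := f_ker _ _ fy; exists v; rewrite jE vy cy.
  - have [y ->] := quot_pi_ex z; have [x <-] := corestr_surj y.
    by exists (c k x); rewrite pE.
split=> [k|k u]; last by rewrite jE.
split=> [x|u z puz]; first exact: pE.
have [x cx] := c_surj k u; rewrite -cx in puz *.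
have [y [cy fy]] := lift_fibre _ _ _ puz.
(* Uniqueness is the joint injectivity of [c] and [f]. *)
exists y; split=> // y' [cy' fy'].
by apply: cf_inj; rewrite ?cy ?fy.
Qed.
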